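(* Let $R$ be a ring with identity (not necessarily commutative) and let $D=\{d_1,d_2,\dots,d_n\}$ be a finite set of derivations of $R$. For $i=0,1,\dots,n$ let $S_i$ denote the set of all polynomials in indeterminates $x_1,x_2,\dots,x_i$ with coefficients in $R$, where $S_0=R$. Define in $S_n$ addition in the usual way and multiplication by the rules $x_i r=r x_i+d_i(r)$ for all $r\in R$ and $i=1,\dots,n$, $x_ix_j=x_jx_i$ for all $i,j=1,\dots,n$, and the distributive law of multiplication with respect to addition. Then $S_i$ is a skew polynomial ring of derivation type over $S_{i-1}$ (in the indeterminate $x_i$) for all $i=1,2,\dots,n$ if and only if $d_i\circ d_j=d_j\circ d_i$ for all $i,j=1,2,\dots,n$.
   Context: A derivation of a ring $A$ is an additive map $d:A\to A$ with $d(ab)=a\,d(b)+d(a)\,b$ for all $a,b\in A$. Given a ring $A$ and a derivation $\delta$ of $A$, the skew polynomial ring of derivation type $A[x;\delta]$ is the set of all polynomials in one variable $x$ with coefficients in $A$ (written on the left, so it is the free left $A$-module on $1,x,x^2,\dots$), with the usual addition and with multiplication determined by $xa=ax+\delta(a)$ for all $a\in A$ and the distributive law. Elements of $S_i$ are finite formal sums $\sum r_{a_1,\dots,a_i}x_1^{a_1}\cdots x_i^{a_i}$ with $r_{a_1,\dots,a_i}\in R$ (free left $R$-module on the monomials). ''$S_i$ is a skew polynomial ring of derivation type over $S_{i-1}$'' means that, with the given operations, $S_i=S_{i-1}[x_i;\delta_i]$ for some derivation $\delta_i$ of $S_{i-1}$ (by the multiplication rules, $\delta_i$ then restricts to $d_i$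 on $R$). *)

(* Defs.v *)
From mathcomp Require Import all_boot all_algebra.
From mathcomp Require Import finmap monalg.

Set Implicit Arguments.
Unset Strict Implicit.
Unset Printing Implicit Defensive.

Import GRing.Theory.
Local Open Scope ring_scope.

Definition derivation (R : pzRingType) (d : R -> R) : Prop :=
  {morph d : a b / a + b} /\ (forall a b, d (a * b) = a * d b + d a * b).

(* The product [mul] below is not assumed to make [T] a ring: whether it is
   associative on a given subset is part of what has to be decided.  Hence
   rings are subsets of [T] that are rings for the operations of [T]. *)
Section SkewPolynomialRing.
Variables (T : zmodType) (mul : T -> T -> T) (one : T).

Record ring_on (A : {pred T}) : Prop := RingOn {
  ring_on_zmod : zmod_closed A;
  ring_on_one : one \in A;
  ring_on_mul : {in A &, forall a b, mul a b \in A};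
  ring_on_mulA : {in A & &, associative mul};
  ring_on_mul1 : {in A, left_id one mul};
  ring_on_mulr1 : {in A, right_id one mul};
  ring_on_mulDl : {in A & &, left_distributive mul +%R};
  ring_on_mulDr : {in A & &, right_distributive mul +%R}
}.

Record derivation_on (B : {pred T}) (delta : T -> T) : Prop := DerivationOn {
  derivation_on_in : {in B, forall a, delta a \in B};
  derivation_on_add : {in B &, {morph delta : a b / a + b}};
  derivation_on_mul : {in B &, forall a b,
    delta (mul a b) = mul a (delta b) + mul (delta a) b}
}.

Definition power (x : T) (k : nat) : T := iter k (mul x) one.

(* [A = B[x; delta]]: [A] is a ring containing the ring [B] and [x], it is free
   as a left [B]-module on 1, x, x^2, etc. (the last two fields), and
   [x b = b x + delta b]. *)
Record skew_polynomial_ring (A B : {pred T}) (x : T) (delta : T -> T) : Prop :=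
  SkewPolynomialRing {
  spr_base : ring_on B;
  spr_delta : derivation_on B delta;
  spr_ring : ring_on A;
  spr_sub : {subset B <= A};
  spr_var : x \in A;
  spr_comm : {in B, forall b, mul x b = mul b x + delta b};
  spr_span : {in A, forall p, exists (N : nat) (b : nat -> T),
    (forall k, b k \in B) /\ p = \sum_(k < N) mul (b k) (power x k)};
  spr_free : forall (N : nat) (b : nat -> T), (forall k, b k \in B) ->
    \sum_(k < N) mul (b k) (power x k) = 0 ->
    forall k, (k < N)%N -> b k = 0
}.

Definition skew_polynomial_ring_over (A B : {pred T}) (x : T) : Prop :=
  exists delta : T -> T, skew_polynomial_ring A B x delta.

End SkewPolynomialRing.

(* [{malg R['X_{1..n}]}] is used for its additive group only: the free left
   [R]-module on the commutative monomials in x_0, ..., x_(n-1). *)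
Section SkewProduct.
Variables (R : pzRingType) (n : nat).
Local Notation S := {malg R['X_{1..n}]}.

Definition skew_const (r : R) : S := << r *g mone >>.

Definition skew_var (i : 'I_n) : S := << 1 *g ucm i >>.

Definition coef_lmul (r : R) (q : S) : S :=
  \sum_(m <- msupp q) << r * q@_m *g m >>.

Variable d : 'I_n -> R -> R.

(* x_i (c m) = (x_i c) m = (c x_i + d_i(c)) m = c (x_i m) + d_i(c) m, where the
   monomial [x_i m] is taken in the free commutative monoid. *)
Definition var_lmul (i : 'I_n) (q : S) : S :=
  \sum_(m <- msupp q) (<< q@_m *g mmul (ucm i) m >> + << d i q@_m *g m >>).

(* Left product by x_0^(m 0) ... x_(n-1)^(m (n-1)): the last variable is applied
   first.  When the [d i] do not commute the result depends on this order, and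
   [skew_mul] is then not associative. *)
Definition monom_lmul (m : 'X_{1..n}) (q : S) : S :=
  foldr (fun i : 'I_n => iter (m i) (var_lmul i)) q (enum 'I_n).

Definition skew_mul (p q : S) : S :=
  \sum_(m <- msupp p) coef_lmul p@_m (monom_lmul m q).

(* Only x_0, ..., x_(i-1) occur; [skew_sub 0] is the copy of [R]. *)
Definition skew_sub (i : nat) : {pred S} :=
  [pred p : S | all (fun m : 'X_{1..n} =>
     [forall j : 'I_n, (i <= j)%N ==> (m j == 0%N)]) (msupp p)].

End SkewProduct.

Arguments skew_sub R n i : clear implicits.

(* [skew_mul] obeys the defining rules, for arbitrary derivations [d i]; and it
   is the only associative product that obeys them. *)
Section SkewProductRules.
Variables (R : pzRingType) (n : nat) (d : 'I_n -> R -> R).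
Hypothesis d_der : forall i, derivation (d i).
Local Notation S := {malg R['X_{1..n}]}.
Local Notation "p ** q" := (skew_mul d p q) (at level 40, left associativity).

Lemma derivation0 (i : 'I_n) : d i 0 = 0.
Proof. by apply: (addrI (d i 0)); rewrite -(d_der i).1 !addr0. Qed.

Lemma derivation1 i : d i 1 = 0.
Proof.
apply: (addrI (d i 1)); rewrite addr0.
by have := (d_der i).2 1 1; rewrite !mulr1 mul1r => <-.
Qed.

Lemma malg_sum_widen (F : 'X_{1..n} -> R -> S) (F0 : forall m, F m 0 = 0)
    (q : S) (D : {fset 'X_{1..n}}) : (msupp q `<=` D)%fset ->
  \sum_(m <- msupp q) F m q@_m = \sum_(m <- D) F m q@_m.
Proof.
move=> sub; apply: big_fset_incl => // m mD mq.
by rewrite mcoeff_outdom.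
Qed.

Lemma malg_sumD (F : 'X_{1..n} -> R -> S)
    (FD : forall m, {morph F m : a b / a + b}) (p q : S) :
  \sum_(m <- msupp (p + q)) F m (p + q)@_m
  = \sum_(m <- msupp p) F m p@_m + \sum_(m <- msupp q) F m q@_m.
Proof.
have F0 m : F m 0 = 0 by apply: (addrI (F m 0)); rewrite -FD !addr0.
rewrite (malg_sum_widen F0 (msuppD_le p q)).
rewrite (malg_sum_widen F0 (fsubsetUl (msupp p) (msupp q))).
rewrite (malg_sum_widen F0 (fsubsetUr (msupp p) (msupp q))).
by rewrite -big_split /=; apply: eq_bigr => m _; rewrite mcoeffD FD.
Qed.

Lemma malg_sumU (F : 'X_{1..n} -> R -> S) (F0 : forall m, F m 0 = 0) r m :
  \sum_(k <- msupp (<< r *g m >> : S)) F k (<< r *g m >> : S)@_k = F m r.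
Proof.
rewrite (malg_sum_widen F0 msuppU_le).
by rewrite big_seq_fset1 mcoeffUU.
Qed.

Lemma coef_lmulD r : {morph @coef_lmul R n r : p q / p + q}.
Proof.
move=> p q; apply: (malg_sumD (F := fun m c => << r * c *g m >>)) => m a b.
by rewrite mulrDr monalgUD.
Qed.

Lemma coef_lmulU (r s : R) (m : 'X_{1..n}) :
  coef_lmul r << s *g m >> = << r * s *g m >>.
Proof.
by apply: (malg_sumU (F := fun m c => << r * c *g m >>)) => k;
  rewrite mulr0 monalgU0.
Qed.

Lemma coef_lmulDl r s (q : S) :
  coef_lmul (r + s) q = coef_lmul r q + coef_lmul s q.
Proof.
rewrite -big_split /=; apply: eq_bigr => m _.
by rewrite mulrDl monalgUD.
Qed.

Lemma var_lmulD i : {morph var_lmul d i : p q / p + q}.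
Proof.
move=> p q; apply: (malg_sumD
  (F := fun m c => << c *g mmul (ucm i) m >> + << d i c *g m >>)) => m a b.
rewrite /= (d_der i).1 (monalgUD _ a b) (monalgUD _ (d i a) (d i b)).
exact: addrACA.
Qed.

Lemma var_lmulU i c m :
  var_lmul d i << c *g m >> = << c *g mmul (ucm i) m >> + << d i c *g m >>.
Proof.
apply: (malg_sumU
  (F := fun m c => << c *g mmul (ucm i) m >> + << d i c *g m >>)) => k.
by rewrite derivation0 !monalgU0 addr0.
Qed.

Lemma monom_lmulD m : {morph monom_lmul d m : p q / p + q}.
Proof.
move=> p q; rewrite /monom_lmul; elim: (enum _) => //= i s ->.
by elim: (m i) => //= k ->; rewrite var_lmulD.
Qed.

Lemma skew_mulDr : right_distributive (skew_mul d) +%R.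
Proof.
move=> p q s; rewrite -big_split /=; apply: eq_bigr => m _.
by rewrite monom_lmulD coef_lmulD.
Qed.

Lemma skew_mulDl : left_distributive (skew_mul d) +%R.
Proof.
move=> p q s.
apply: (malg_sumD (F := fun m c => coef_lmul c (monom_lmul d m s))) => m a b.
exact: coef_lmulDl.
Qed.

Lemma skew_mulU r m q : << r *g m >> ** q = coef_lmul r (monom_lmul d m q).
Proof.
apply: (malg_sumU (F := fun m c => coef_lmul c (monom_lmul d m q))) => k.
by rewrite /coef_lmul big1 // => j _; rewrite mul0r monalgU0.
Qed.

Lemma monom_lmul1 (q : S) : monom_lmul d mone q = q.
Proof. by rewrite /monom_lmul; elim: (enum _) => //= i s ->; rewrite cm1. Qed.

Lemma coef_lmul1 (q : S) : coef_lmul 1 q = q.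
Proof.
rewrite [RHS]monalgE; apply: eq_bigr => m _.
by rewrite mul1r.
Qed.

Lemma monom_lmul_var i (q : S) : monom_lmul d (ucm i) q = var_lmul d i q.
Proof.
have out s : i \notin s ->
    foldr (fun j : 'I_n => iter (ucm i j) (var_lmul d j)) q s = q.
  elim: s => //= j s IH; rewrite inE negb_or => /andP[ij /IH ->].
  by rewrite cmU (negbTE ij).
have : i \in enum 'I_n by rewrite mem_enum.
rewrite /monom_lmul; elim: (enum _) (enum_uniq 'I_n) => //= j s IH.
case/andP=> js us; rewrite inE cmU; have [ij _|_ /= si] := eqVneq i j.
  by rewrite -ij [LHS]/= out // ij.
exact: (IH us si).
Qed.

Lemma var_lmul_monom i (m : 'X_{1..n}) :
  var_lmul d i << 1 *g m >> = << 1 *g mmul (ucm i) m >>.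
Proof. by rewrite var_lmulU derivation1 monalgU0 addr0. Qed.

Lemma skew_const_mul r (q : S) : skew_const n r ** q = coef_lmul r q.
Proof. by have := skew_mulU r mone q; rewrite monom_lmul1. Qed.

Lemma skew_var_mul i (q : S) : skew_var R i ** q = var_lmul d i q.
Proof. by have := skew_mulU 1 (ucm i) q; rewrite monom_lmul_var coef_lmul1. Qed.

Lemma skew_const_monom r s (m : 'X_{1..n}) :
  skew_const n r ** << s *g m >> = << r * s *g m >>.
Proof. by rewrite skew_const_mul coef_lmulU. Qed.

Lemma skew_var_monom i (m : 'X_{1..n}) :
  skew_var R i ** << 1 *g m >> = << 1 *g mmul (ucm i) m >>.
Proof. by rewrite skew_var_mul var_lmul_monom. Qed.

Lemma skew_var_const i r :
  skew_var R i ** skew_const n r =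
  skew_const n r ** skew_var R i + skew_const n (d i r).
Proof.
have vE : skew_var R i ** skew_const n r
    = << r *g ucm i >> + << d i r *g mone >>.
  by rewrite skew_var_mul -[in RHS](mulm1 (ucm i)); exact: var_lmulU.
have cE : skew_const n r ** skew_var R i = << r *g ucm i >>.
  by rewrite -[r in RHS]mulr1; exact: skew_const_monom.
by apply: (etrans vE); congr (_ + _); apply/esym.
Qed.

Lemma skew_varC i j :
  skew_var R i ** skew_var R j = skew_var R j ** skew_var R i.
Proof. have vE k l : skew_var R k ** skew_var R l = << 1 *g mmul (ucm k) (ucm l) >>.
  exact: skew_var_monom.
by apply: (etrans (vE i j)); rewrite mulmC; apply/esym/vE. Qed.

Lemma additive_monom_ext (f g : S -> S) :
  {morph f : p q / p + q} -> {morph g : p q / p + q} ->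
  (forall c m, f << c *g m >> = g << c *g m >>) -> f =1 g.
Proof.
move=> fD gD fg q.
have f0 : f 0 = 0 by apply: (addrI (f 0)); rewrite -fD !addr0.
have g0 : g 0 = 0 by apply: (addrI (g 0)); rewrite -gD !addr0.
rewrite (monalgE q) (big_morph f fD f0) (big_morph g gD g0).
by apply: eq_bigr => m _.
Qed.

Lemma monom_lmul_one (m : 'X_{1..n}) :
  monom_lmul d m (skew_const n 1) = << 1 *g m >>.
Proof.
have step (s : seq 'I_n) : uniq s ->
    exists2 k : 'X_{1..n}, (forall j, k j = (if j \in s then m j else 0)%N) &
    foldr (fun i : 'I_n => iter (m i) (var_lmul d i)) (skew_const n 1) s
    = << 1 *g k >>.
  elim: s => [|i s IH] /=; first by exists mone => // j; rewrite cm1.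
  case/andP=> si /IH[k kE ->] {IH}.
  have it e : exists2 l : 'X_{1..n}, (forall j, l j = k j + e * (i == j))%N &
      iter e (var_lmul d i) << 1 *g k >> = << 1 *g l >>.
    elim: e => [|e [l lE IH]] /=; first by exists k => // j; rewrite addn0.
    exists (mmul (ucm i) l); last first.
      exact: (etrans (congr1 _ IH) (var_lmul_monom i l)).
    by move=> j; rewrite cmM lE cmU mulSn addnCA.
  have [l lE ->] := it (m i); exists l => // j.
  rewrite lE kE inE eq_sym; have [->|_] := eqVneq j i; last by rewrite muln0 addn0.
  by rewrite (negbTE si) muln1.
have [k kE kF] := step _ (enum_uniq 'I_n); rewrite [LHS]kF.
have <- : k = m.
  by apply/eqP; apply/cmP => j; rewrite (kE j) mem_enum.
reflexivity.
Qed.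

Lemma skew_mul_unique (mul : S -> S -> S) :
  associative mul ->
  left_distributive mul +%R -> right_distributive mul +%R ->
  (forall r s m, mul (skew_const n r) << s *g m >> = << r * s *g m >>) ->
  (forall i m, mul (skew_var R i) << 1 *g m >> = << 1 *g mmul (ucm i) m >>) ->
  (forall i r, mul (skew_var R i) (skew_const n r) =
     mul (skew_const n r) (skew_var R i) + skew_const n (d i r)) ->
  mul =2 skew_mul d.
Proof.
move=> mulA mulDl mulDr mulC mulX mulXC.
have split_monom c m : << c *g m >> = mul (skew_const n c) << 1 *g m >>.
  by rewrite mulC mulr1.
have mul_var i : mul (skew_var R i) =1 var_lmul d i.
  apply: additive_monom_ext => [p q|p q|c m]; first exact: mulDr.
    exact: var_lmulD.
  apply: etrans (esym (var_lmulU i c m)).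
  apply: (etrans (congr1 _ (split_monom c m))); apply: (etrans (mulA _ _ _)).
  apply: (etrans (congr1 (mul^~ _) (mulXC i c))); apply: (etrans (mulDl _ _ _)).
  congr (_ + _); last exact: esym (split_monom (d i c) m).
  apply: (etrans (esym (mulA _ _ _))); apply: (etrans (congr1 _ (mulX i m))).
  exact: esym (split_monom c (mmul (ucm i) m)).
have mul_const r : mul (skew_const n r) =1 coef_lmul r.
  apply: additive_monom_ext => [p q|p q|c m]; first exact: mulDr.
    exact: coef_lmulD.
  exact: (etrans (mulC r c m) (esym (coef_lmulU r c m))).
have mul_monom m : mul << 1 *g m >> =1 monom_lmul d m.
  move=> q; rewrite -monom_lmul_one /monom_lmul.
  elim: (enum _) => /= [|i s <-]; first by rewrite mul_const coef_lmul1.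
  elim: (m i) => //= e <-; rewrite -(mul_var i (mul _ q)) mulA.
  exact: (congr1 (mul^~ q) (esym (mul_var i _))).
move=> p q; apply: (additive_monom_ext (f := mul^~ q) (g := skew_mul d ^~ q)).
- by move=> a b; apply: mulDl.
- by move=> a b; apply: skew_mulDl.
move=> c m.
apply: etrans (esym (skew_mulU c m q)).
apply: (etrans (congr1 (mul^~ q) (split_monom c m))).
apply: (etrans (esym (mulA _ _ _))); apply: (etrans (mul_const c _)).
exact: (congr1 _ (mul_monom m q)).
Qed.

End SkewProductRules.

(* Main.v *)
Require Import Defs.
From mathcomp Require Import all_boot all_algebra.
From mathcomp Require Import finmap monalg.

(* If S_n is associative then x_i (x_j r) = x_j (x_i r), and the constant terms
   of the two sides are d_i (d_j r) and d_j (d_i r).  Conversely, if the d_i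
   commute then so do the operators X_i of left multiplication by x_i on the
   free module; hence the left multiplication by a monomial is multiplicative
   in the monomial, and associativity follows from X_i c = c X_i + d_i(c).
   In the associative ring S_n the map delta_i is b |-> x_i b - b x_i, and S_i is
   free over S_(i-1) since right multiplication by x_i^k shifts the monomials. *)

Set Implicit Arguments.
Unset Strict Implicit.
Unset Printing Implicit Defensive.

Import GRing.Theory.
Local Open Scope ring_scope.

(** * Supports: the subsets S_i and their closure under the operations *)

Section Supports.
Variables (R : pzRingType) (n : nat).
Local Notation S := {malg R['X_{1..n}]}.

Lemma skew_subP i (p : S) :
  reflect (forall m, m \in msupp p -> forall j : 'I_n, (i <= j)%N -> m j = 0%N)
    (p \in skew_sub R n i).
Proof.
apply: (iffP allP) => pP m /pP; last first.
  by move=> mP; apply/forallP => j; apply/implyP => /mP/eqP.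
by move=> /forallP mP j ij; apply/eqP; apply: (implyP (mP j)).
Qed.

Lemma skew_sub_zmod i : zmod_closed (skew_sub R n i).
Proof.
split=> [|p q /skew_subP pP /skew_subP qP].
  by apply/skew_subP => m; rewrite msupp0.
apply/skew_subP => m /(fsubsetP (msuppB_le p q)).
by rewrite in_fsetU => /orP[/pP|/qP].
Qed.

Lemma skew_sub0 i : 0 \in skew_sub R n i.
Proof. by case: (skew_sub_zmod i). Qed.

Lemma skew_subB i (p q : S) :
  p \in skew_sub R n i -> q \in skew_sub R n i -> p - q \in skew_sub R n i.
Proof. by case: (skew_sub_zmod i) => _; apply. Qed.

Lemma skew_subD i (p q : S) :
  p \in skew_sub R n i -> q \in skew_sub R n i -> p + q \in skew_sub R n i.
Proof.
move=> pS qS; rewrite -[q]opprK; refine (skew_subB pS _).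
by rewrite -[- q]sub0r; refine (skew_subB _ qS); apply: skew_sub0.
Qed.

Lemma skew_sub_sum i (I : eqType) (r : seq I) (P : pred I) (F : I -> S) :
  (forall k, k \in r -> P k -> F k \in skew_sub R n i) ->
  \sum_(k <- r | P k) F k \in skew_sub R n i.
Proof.
move=> FS; rewrite big_seq_cond.
apply: (big_ind (fun p => p \in skew_sub R n i)) => [|p q|k /andP[]].
- exact: skew_sub0.
- exact: skew_subD.
- exact: FS.
Qed.

Lemma skew_subU i c (m : 'X_{1..n}) :
  (forall j : 'I_n, (i <= j)%N -> m j = 0%N) -> << c *g m >> \in skew_sub R n i.
Proof.
move=> mP; apply/skew_subP => k /(fsubsetP msuppU_le).
by rewrite in_fset1 => /eqP ->.
Qed.

Lemma skew_subS i j : (i <= j)%N -> {subset skew_sub R n i <= skew_sub R n j}.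
Proof.
move=> ij p /skew_subP pP; apply/skew_subP => m /pP mP k jk.
exact: mP (leq_trans ij jk).
Qed.

Lemma skew_sub_full i (p : S) : (n <= i)%N -> p \in skew_sub R n i.
Proof.
move=> ni; apply/skew_subP => m _ j ij.
by have := leq_trans (ltn_ord j) (leq_trans ni ij); rewrite ltnn.
Qed.

Lemma coef_lmul_sub i r :
  {in skew_sub R n i, forall q, coef_lmul r q \in skew_sub R n i}.
Proof.
move=> q /skew_subP qP; apply: skew_sub_sum => m /qP mP _.
exact: skew_subU.
Qed.

Lemma var_lmul_sub (d : 'I_n -> R -> R) i (j : 'I_n) : (j < i)%N ->
  {in skew_sub R n i, forall q, var_lmul d j q \in skew_sub R n i}.
Proof.
move=> ji q /skew_subP qP; apply: skew_sub_sum => m /qP mP _.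
apply: skew_subD; apply: skew_subU => // k ik.
rewrite cmM cmU mP // addn0; have [jk|//] := eqVneq j k.
by rewrite -jk leqNgt ji in ik.
Qed.

(** An operator [var_lmul d j] with [i <= j] would leave S_i, but it is iterated [m j = 0] times. *)
Lemma monom_lmul_sub (d : 'I_n -> R -> R) i (m : 'X_{1..n}) :
  (forall j : 'I_n, (i <= j)%N -> m j = 0%N) ->
  {in skew_sub R n i, forall q, monom_lmul d m q \in skew_sub R n i}.
Proof.
move=> mP q qS; rewrite /monom_lmul; elim: (enum _) => //= j s IH.
have [ij|ji] := leqP i j; first by rewrite mP.
by elim: (m j) => //= e; apply: var_lmul_sub.
Qed.

Lemma skew_mul_sub (d : 'I_n -> R -> R) i :
  {in skew_sub R n i &, forall p q, skew_mul d p q \in skew_sub R n i}.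
Proof.
move=> p q /skew_subP pP qS; apply: skew_sub_sum => m /pP mP _.
exact/coef_lmul_sub/monom_lmul_sub.
Qed.

End Supports.

(** * Associativity from commuting operators on a module spanned by monomials *)

Section MonomialOperators.
Variables (R : pzRingType) (n : nat) (d : 'I_n -> R -> R) (S : zmodType).
Variables (term : R -> 'X_{1..n} -> S) (L : R -> S -> S) (X : 'I_n -> S -> S).
Variable mul : S -> S -> S.
Local Notation "p ** q" := (mul p q) (at level 40, left associativity).

(** Abstract form of [monom_lmul]. In this section the module is known only through its generators
    [term c m]: by [term_ext], identities between additive maps are checked on them. *)
Definition iter_monom (m : 'X_{1..n}) (q : S) : S :=
  foldr (fun i : 'I_n => iter (m i) (X i)) q (enum 'I_n).

Hypothesis d_der : forall i, derivation (d i).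
Hypothesis d_comm : forall i j : 'I_n, d i \o d j =1 d j \o d i.
Hypothesis termD : forall m a b, term (a + b) m = term a m + term b m.
Hypothesis term_ext : forall f g : S -> S,
  {morph f : p q / p + q} -> {morph g : p q / p + q} ->
  (forall c m, f (term c m) = g (term c m)) -> f =1 g.
Hypothesis LD : forall r, {morph L r : p q / p + q}.
Hypothesis LU : forall r c m, L r (term c m) = term (r * c) m.
Hypothesis XD : forall i, {morph X i : p q / p + q}.
Hypothesis XU : forall i c m,
  X i (term c m) = term c (mmul (ucm i) m) + term (d i c) m.
Hypothesis mulDl : left_distributive mul +%R.
Hypothesis mulDr : right_distributive mul +%R.
Hypothesis mulU : forall c m q, term c m ** q = L c (iter_monom m q).
Hypothesis iter_monom_var : forall i q, iter_monom (ucm i) q = X i q.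
Hypothesis iter_monom_one : forall m, iter_monom m (term 1 mone) = term 1 m.

Lemma coef_coef r s q : L r (L s q) = L (r * s) q.
Proof.
apply: (term_ext (f := fun q => L r (L s q))) => [p p'|p p'|c m].
- by rewrite !LD.
- exact: LD.
- by rewrite !LU mulrA.
Qed.

(** The rule x_i r = r x_i + d_i(r) between operators; on a generator it is the Leibniz rule for
    [d i (r * c)]. *)
Lemma var_coef i r q : X i (L r q) = L r (X i q) + L (d i r) q.
Proof.
apply: (term_ext (f := fun q => X i (L r q))
  (g := fun q => L r (X i q) + L (d i r) q)) => [p p'|p p'|c m].
- by rewrite LD XD.
- by rewrite XD !LD addrACA.
- by rewrite XU LD !LU XU (d_der i).2 termD addrA.
Qed.

(** On c m both sides expand to c x_i x_j m, d_j(c) x_i m, d_i(c) x_j m and a last term d_i(d_j(c))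
    m or d_j(d_i(c)) m; these last terms agree by [d_comm]. *)
Lemma var_var i j q : X i (X j q) = X j (X i q).
Proof.
apply: (term_ext (f := fun q => X i (X j q))
  (g := fun q => X j (X i q))) => [p p'|p p'|c m].
- by rewrite !XD.
- by rewrite !XD.
- have dC : d i (d j c) = d j (d i c) by apply: d_comm.
  by rewrite !(XU, XD) dC mulmA (mulmC (ucm i)) -mulmA addrACA.
Qed.

(** Since the [X i] commute, a power of [X j] moves through a whole fold ([foldC]), so the exponents
    can be regrouped one variable at a time. *)
Lemma iter_monomM m k q : iter_monom (mmul m k) q = iter_monom m (iter_monom k q).
Proof.
have iterC i j e p : iter e (X i) (X j p) = X j (iter e (X i) p).
  by elim: e => //= e ->; rewrite var_var.
have foldC j e s p :
    foldr (fun i : 'I_n => iter (m i) (X i)) (iter e (X j) p) s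
    = iter e (X j) (foldr (fun i : 'I_n => iter (m i) (X i)) p s).
  by elim: e => //= e <-; elim: s => //= i s ->; apply: iterC.
rewrite /iter_monom; elim: (enum _) => //= i s ->.
by rewrite cmM iterD foldC.
Qed.

Lemma coef_mul r p q : L r p ** q = L r (p ** q).
Proof.
apply: (term_ext (f := fun p => L r p ** q)
  (g := fun p => L r (p ** q))) => [p1 p2|p1 p2|c m].
- by rewrite LD mulDl.
- by rewrite mulDl LD.
- by rewrite LU !mulU coef_coef.
Qed.

(** For p = c m the left side is the action of c (x_i m) + d_i(c) m on q; [iter_monomM] splits off
    x_i and [var_coef] moves it in front of c. *)
Lemma var_mul i p q : X i p ** q = X i (p ** q).
Proof.
apply: (term_ext (f := fun p => X i p ** q)
  (g := fun p => X i (p ** q))) => [p1 p2|p1 p2|c m].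
- by rewrite XD mulDl.
- by rewrite mulDl XD.
- by rewrite XU mulDl !mulU var_coef iter_monomM iter_monom_var.
Qed.

Lemma iter_monom_mul m p q : iter_monom m p ** q = iter_monom m (p ** q).
Proof.
rewrite /iter_monom; elim: (enum _) => //= i s <-.
by elim: (m i) => //= e <-; rewrite var_mul.
Qed.

(** Left multiplication by c m is [L c] after [iter_monom m], and both commute with right
    multiplications. *)
Lemma monom_mulA : associative mul.
Proof.
move=> p q s; apply: (term_ext (f := fun p => p ** (q ** s))
  (g := fun p => p ** q ** s)) => [p1 p2|p1 p2|c m].
- exact: mulDl.
- by rewrite !mulDl.
- by rewrite !mulU coef_mul iter_monom_mul.
Qed.

Lemma monom_mulUU c m k : term c m ** term 1 k = term c (mmul m k).
Proof.
by rewrite mulU -(iter_monom_one k) -iter_monomM iter_monom_one LU mulr1.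
Qed.

End MonomialOperators.

(** * Commutators with a fixed element *)

Section InnerDerivation.
Variables (S : zmodType) (mul : S -> S -> S).
Hypothesis mulA : associative mul.
Hypothesis mulDl : left_distributive mul +%R.
Hypothesis mulDr : right_distributive mul +%R.
Local Notation "p ** q" := (mul p q) (at level 40, left associativity).

Definition inner_derivation (x b : S) : S := x ** b - b ** x.

Lemma inner_derivationD x : {morph inner_derivation x : p q / p + q}.
Proof. by move=> p q; rewrite /inner_derivation mulDr mulDl opprD addrACA. Qed.

Lemma inner_derivationM x p q : inner_derivation x (p ** q)
  = p ** inner_derivation x q + inner_derivation x p ** q.
Proof.
have mulB a b c : a ** (b - c) = a ** b - a ** c.
  by apply: (addIr (a ** c)); rewrite -mulDr !subrK.
have mulBl a b c : (a - b) ** c = a ** c - b ** c.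
  by apply: (addIr (b ** c)); rewrite -mulDl !subrK.
(* With the summands swapped, the two copies of p x q are adjacent and cancel. *)
by rewrite /inner_derivation mulB mulBl !mulA [RHS]addrC subrKA.
Qed.

End InnerDerivation.

(** * The product on S_n: associativity and commuting derivations *)

Section SkewProduct.
Variables (R : pzRingType) (n : nat) (d : 'I_n -> R -> R).
Hypothesis d_der : forall i, derivation (d i).
Local Notation S := {malg R['X_{1..n}]}.
Local Notation "p ** q" := (skew_mul d p q) (at level 40, left associativity).

Lemma skew_mul0l (q : S) : 0 ** q = 0.
Proof. by rewrite /skew_mul msupp0 big_seq_fset0. Qed.

Lemma skew_mul1l (q : S) : skew_const n 1 ** q = q.
Proof. by rewrite skew_const_mul coef_lmul1. Qed.

Lemma skew_mul1r (q : S) : q ** skew_const n 1 = q.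
Proof.
apply: (additive_monom_ext (f := skew_mul d ^~ (skew_const n 1))
  (g := id)) => [p p'|//|c m]; first exact: skew_mulDl.
by rewrite skew_mulU monom_lmul_one // coef_lmulU mulr1.
Qed.

(** The monomial x_i m is never 1, so only the term d_i(c) m can reach the constant coefficient. *)
Lemma mcoeff1_var i c m :
  (var_lmul d i << c *g m >>)@_mone = d i c *+ (m == mone).
Proof.
apply: (etrans (congr1 (mcoeff mone) (var_lmulU d_der i c m))).
apply: (etrans (mcoeffD _ _ _)).
apply: (etrans (congr2 +%R (mcoeffU _ _ _) (mcoeffU _ _ _))).
by rewrite cmM_eq1 cm1_eq1 add0r.
Qed.

Lemma mcoeff1_var_var i j r :
  (skew_var R i ** (skew_var R j ** skew_const n r))@_mone = d i (d j r).
Proof.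
have jE : skew_var R j ** skew_const n r
    = << r *g mmul (ucm j) mone >> + << d j r *g mone >>.
  by rewrite skew_var_mul; exact: var_lmulU.
rewrite skew_var_mul jE var_lmulD // mcoeffD.
apply: (etrans (congr2 +%R (mcoeff1_var _ _ _) (mcoeff1_var _ _ _))).
by rewrite cmM_eq1 cm1_eq1 eqxx add0r.
Qed.

Lemma skew_mulA_comm : associative (skew_mul d) ->
  forall i j : 'I_n, d i \o d j =1 d j \o d i.
Proof.
move=> mulA i j r /=.
rewrite -(mcoeff1_var_var i j) -(mcoeff1_var_var j i); apply: congr1.
rewrite [LHS]mulA [RHS]mulA.
exact: (congr1 (skew_mul d ^~ _) (skew_varC d_der i j)).
Qed.

Hypothesis d_comm : forall i j : 'I_n, d i \o d j =1 d j \o d i.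

Lemma skew_mulA : associative (skew_mul d).
Proof.
apply: (monom_mulA (term := fun c m => << c *g m >>) (L := @coef_lmul R n)
  (X := var_lmul d) d_der d_comm).
- by move=> m a b; apply: monalgUD.
- exact: additive_monom_ext.
- exact: coef_lmulD.
- exact: coef_lmulU.
- exact: var_lmulD.
- exact: var_lmulU.
- exact: skew_mulDl.
- exact: skew_mulU.
- exact: monom_lmul_var.
Qed.

(** The right factor has coefficient 1, which every derivation kills, so no lower terms appear. *)
Lemma skew_mulUU c (m k : 'X_{1..n}) :
  << c *g m >> ** << 1 *g k >> = << c *g mmul m k >>.
Proof.
apply: (monom_mulUU (term := fun c m => << c *g m >>) (L := @coef_lmul R n)
  (X := var_lmul d) d_comm).
- exact: additive_monom_ext.
- exact: coef_lmulU.
- exact: var_lmulD.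
- exact: var_lmulU.
- exact: skew_mulU.
- exact: monom_lmul_one.
Qed.

Lemma skew_mul_monom (p : S) k :
  p ** << 1 *g k >> = \sum_(m <- msupp p) << p@_m *g mmul m k >>.
Proof.
rewrite [in LHS](monalgE p).
rewrite (big_morph (skew_mul d ^~ _) (fun a b => skew_mulDl d a b _) (skew_mul0l _)).
by apply: eq_bigr => m _; rewrite skew_mulUU.
Qed.

Lemma ring_on_skew_sub i : ring_on (skew_mul d) (skew_const n 1) (skew_sub R n i).
Proof.
split.
- exact: skew_sub_zmod.
- by apply: skew_subU => j _; rewrite cm1.
- exact: skew_mul_sub.
- by move=> p q s _ _ _; apply: skew_mulA.
- by move=> p _; apply: skew_mul1l.
- by move=> p _; apply: skew_mul1r.
- by move=> p q s _ _ _; apply: skew_mulDl.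
- by move=> p q s _ _ _; apply: skew_mulDr.
Qed.

(** * S_(i+1) as a skew polynomial ring over S_i, with variables counted from 0 *)

Section NewVariable.
Variable i : 'I_n.

Definition var_exp (k : nat) : 'X_{1..n} := iter k (mmul (ucm i)) mone.

Lemma var_expE k j : var_exp k j = (k * (i == j))%N.
Proof.
elim: k => [|k IH]; first by rewrite [var_exp 0]/= cm1.
by rewrite [var_exp _]/= cmM cmU IH mulSn.
Qed.

Lemma power_skew_var k :
  power (skew_mul d) (skew_const n 1) (skew_var R i) k = << 1 *g var_exp k >>.
Proof.
elim: k => [|k IH]; first by [].
apply: (etrans (congr1 (skew_mul d (skew_var R i)) IH)).
exact: skew_var_monom.
Qed.

Definition skew_delta : S -> S := inner_derivation (skew_mul d) (skew_var R i).

(** Thus the commutator with x_i is [d i] applied to each coefficient; it creates no new monomials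
    and so preserves every [skew_sub R n k]. *)
Lemma skew_deltaU c m : skew_delta << c *g m >> = << d i c *g m >>.
Proof.
have cxE : << c *g m >> ** skew_var R i = << c *g mmul (ucm i) m >>.
  by rewrite mulmC; apply: skew_mulUU.
have xcE : skew_var R i ** << c *g m >>
    = << c *g mmul (ucm i) m >> + << d i c *g m >>.
  by rewrite skew_var_mul; apply: var_lmulU.
have subDl (V : zmodType) (x y a b : V) : x = a + b -> y = a -> x - y = b.
  by move=> -> ->; rewrite addrAC subrr add0r.
exact: subDl xcE cxE.
Qed.

Lemma skew_delta_derivation k :
  derivation_on (skew_mul d) (skew_sub R n k) skew_delta.
Proof.
have skew_deltaD : {morph skew_delta : p q / p + q}.
  exact: (inner_derivationD (@skew_mulDl _ _ d) (skew_mulDr d_der)).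
split=> [b /skew_subP bP|p q _ _|p q _ _].
- have d0 : skew_delta 0 = 0.
    by apply: (addrI (skew_delta 0)); rewrite -skew_deltaD !addr0.
  rewrite (monalgE b) (big_morph _ skew_deltaD d0).
  apply: skew_sub_sum => m /bP mP _; rewrite skew_deltaU; exact: skew_subU.
- exact: skew_deltaD.
- exact: (inner_derivationM skew_mulA (@skew_mulDl _ _ d) (skew_mulDr d_der)).
Qed.

Lemma skew_sub_span (p : S) : p \in skew_sub R n i.+1 ->
  exists (N : nat) (b : nat -> S), (forall k, b k \in skew_sub R n i) /\
    p = \sum_(k < N) b k ** power (skew_mul d) (skew_const n 1) (skew_var R i) k.
Proof.
move=> /skew_subP pP.
(* One more than the degree of p in x_i, as the sum runs over [k < N]. *)
exists (\max_(m <- msupp p) m i).+1.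
(* The k-th coefficient collects the terms of exact degree k in x_i, with x_i^k divided out. *)
exists (fun k => \sum_(m <- msupp p | m i == k) << p@_m *g divcm m (var_exp k) >>).
split=> [k|].
  apply: skew_sub_sum => m mp /eqP mk; apply: skew_subU => j ij.
  rewrite divcmE var_expE; have [<-|ne] := eqVneq i j; first by rewrite muln1 mk subnn.
  by rewrite muln0 subn0 (pP m) // ltn_neqAle ne.
have powE k :
    (\sum_(m <- msupp p | m i == k) << p@_m *g divcm m (var_exp k) >>)
      ** power (skew_mul d) (skew_const n 1) (skew_var R i) k
    = \sum_(m <- msupp p | m i == k) << p@_m *g m >>.
  rewrite power_skew_var.
  rewrite (big_morph (skew_mul d ^~ _) (fun a b => skew_mulDl d a b _) (skew_mul0l _)).
  apply: eq_bigr => m mk.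
  have mE : mmul (divcm m (var_exp k)) (var_exp k) = m.
    apply/eqP/cmP => j; rewrite cmM divcmE subnK // var_expE.
    by have [<-|_] := eqVneq i j; rewrite ?muln0 // muln1 (eqP mk).
  apply: (etrans (skew_mulUU p@_m (divcm m (var_exp k)) (var_exp k))).
  exact: (congr1 (mkmalgU^~ p@_m) mE).
apply: (etrans _ (esym (eq_bigr _ (fun (k : 'I_ _) _ => powE k)))).
rewrite [LHS]monalgE.
(* After the exchange, each monomial m of p is met for the single value k = [m i]. *)
rewrite (exchange_big_dep xpredT) //= big_seq [RHS]big_seq.
apply: eq_bigr => m mp.
have mN : (m i < (\max_(m <- msupp p) m i).+1)%N
  by rewrite ltnS; exact:
    (leq_bigmax_seq (P := xpredT) (F := fun m : 'X_{1..n} => m i) m mp).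
by rewrite (big_pred1 (Ordinal mN)) // => k; rewrite eq_sym.
Qed.

(** Neither m nor the monomials m' of b contain x_i. Hence m' x_i^k = m x_i^l forces k = l by
    comparing exponents of x_i, and then m' = m. *)
Lemma mcoeff_skew_mul_var_exp (b : S) k l (m : 'X_{1..n}) :
  b \in skew_sub R n i -> m i = 0%N ->
  (b ** << 1 *g var_exp k >>)@_(mmul m (var_exp l)) = if k == l then b@_m else 0.
Proof.
move=> /skew_subP bP mi0; rewrite skew_mul_monom (raddf_sum (mcoeff _)) /=.
have eqm m' : m' \in msupp b ->
    (mmul m' (var_exp k) == mmul m (var_exp l)) = (k == l) && (m' == m).
  move=> /bP/(_ i (leqnn i)) m'i0; apply/eqP/andP => [E|[/eqP -> /eqP ->]//].
  have Ej j : (m' j + k * (i == j) = m j + l * (i == j))%N.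
    by rewrite -!var_expE -!cmM E.
  have kl : k = l by have := Ej i; rewrite eqxx m'i0 mi0 !muln1.
  split; first exact/eqP.
  by apply/cmP => j; have := Ej j; rewrite kl => /addIn.
rewrite big_seq; under eq_bigr => m' m'b do rewrite mcoeffU eqm //.
rewrite -big_seq; have [_|_] := eqVneq k l; last by rewrite big1.
rewrite [in RHS](monalgE b) (raddf_sum (mcoeff _)) /=.
by apply: eq_bigr => m' _; rewrite mcoeffU.
Qed.

Lemma skew_sub_free N (b : nat -> S) : (forall k, b k \in skew_sub R n i) ->
  \sum_(k < N) b k ** power (skew_mul d) (skew_const n 1) (skew_var R i) k = 0 ->
  forall k, (k < N)%N -> b k = 0.
Proof.
move=> bS sum0 k kN; apply/malgP => m; rewrite mcoeff0.
(* A monomial containing x_i is absent from [b k]. For any other m, the coefficient of m x_i^k in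
   the vanishing sum is that of m in [b k]. *)
have [mi0|mi] := eqVneq (m i) 0%N; last first.
  apply: mcoeff_outdom; apply: contraNN mi => mb.
  by rewrite (skew_subP _ _ (bS k)).
have coefE (l : 'I_N) : (b l **
      power (skew_mul d) (skew_const n 1) (skew_var R i) l)@_(mmul m (var_exp k))
    = if l == Ordinal kN then (b l)@_m else 0.
  by rewrite power_skew_var mcoeff_skew_mul_var_exp.
have := congr1 (mcoeff (mmul m (var_exp k))) sum0.
rewrite mcoeff0 (raddf_sum (mcoeff _)) /= => sum0m.
apply: (etrans _ sum0m); apply: (etrans _ (esym (eq_bigr _ (fun l _ => coefE l)))).
by rewrite -big_mkcond big_pred1_eq.
Qed.

Lemma skew_polynomial_ring_skew_sub :
  skew_polynomial_ring (skew_mul d) (skew_const n 1)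
    (skew_sub R n i.+1) (skew_sub R n i) (skew_var R i) skew_delta.
Proof.
split.
- exact: ring_on_skew_sub.
- exact: skew_delta_derivation.
- exact: ring_on_skew_sub.
- exact: skew_subS.
- apply: skew_subU => j ij; rewrite cmU; have [ji|//] := eqVneq i j.
  by rewrite -ji ltnn in ij.
- by move=> b _; rewrite addrC subrK.
- exact: skew_sub_span.
- exact: skew_sub_free.
Qed.

End NewVariable.
End SkewProduct.

(** * The equivalence *)

Theorem theorem3p7 (R : pzRingType) (n : nat) (d : 'I_n -> R -> R)
    (hd : forall i : 'I_n, derivation (d i)) :
  (forall i : 'I_n,
     skew_polynomial_ring_over (skew_mul d) (skew_const n 1)
       (skew_sub R n i.+1) (skew_sub R n i) (skew_var R i))
  <->
  (forall i j : 'I_n, d i \o d j =1 d j \o d i).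
Proof.
split=> [spr i j | d_comm i]; last first.
  by exists (skew_delta d i); apply: skew_polynomial_ring_skew_sub.
apply: (skew_mulA_comm hd) => p q s.
(* The index [i] shows that n is positive, so there is a last extension; its top ring S_n contains
   every element, and its associativity is that of [skew_mul d]. *)
have lt_pred : (n.-1 < n)%N by rewrite ltn_predL (leq_ltn_trans _ (ltn_ord i)).
have [delta /spr_ring/ring_on_mulA mulA] := spr (Ordinal lt_pred).
by apply: mulA; apply: skew_sub_full; apply: leqSpred.
Qed.
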